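(* Every quiver in the class $\mathcal{L}$ of Louise quivers is mutation-equivalent to a quiver in the class $\mathcal{L}'$ of Louise prime quivers; i.e., $\mathcal{L}=\mathcal{L}'$.
   Context: A quiver $Q=(Q_0,Q_1)$ is a finite multidigraph (multiple arrows allowed) without loops and directed 2-cycles, with vertex set $Q_0$ and arrow set $Q_1$; the empty quiver (no vertices) is allowed and counts as an acyclic quiver without arrows. A quiver is acyclic if it contains no directed cycles. A vertex $i$ is a source (respectively sink) if no arrow ends (respectively begins) at $i$. For $S\subseteq Q_0$, $Q\setminus S$ denotes the full subquiver induced by the vertices $Q_0\setminus S$, i.e. all arrows of $Q$ that start and end in $Q_0\setminus S$. Mutation of $Q$ at a vertex $i$: $\mu_i(Q)$ is obtained from $Q$ by (1) for each path $j\to i\to k$ of length 2 through $i$ (counted with multiplicity) adding an arrow $j\to k$; (2) reversing all arrows that begin or end at $i$; (3) deleting (cancelling, pair by pair) the 2-cycles that have appeared as a result of step (1). All vertices are mutable. Two quivers are mutation-equivalent if one is obtained from the other by a finite sequence of mutations. A bi-infinite path in $Q$ is a sequence $(i_a)_{a\in\mathbb{Z}}$ of vertices such that $i_a\to i_{a+1}$ is an arrow of $Q$ for every $a\in\mathbb{Z}$ (vertices may repeat). A pair of vertices $(i,j)$ is a covering pair if $i\to j$ is an arrow in $Q$ which is not part of any bi-infinite path. The class $\mathcal{L}$ of Louise quivers is the smallest class of quivers such that: any acyclic quiver is in $\mathcal{L}$; any quiver mutation-equivalent to a quiver in $\mathcal{L}$ is in $\mathcal{L}$; and any quiver $Q$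 with a covering pair $(i,j)$ such that $Q\setminus\{i\}$, $Q\setminus\{j\}$ and $Q\setminus\{i,j\}$ are all in $\mathcal{L}$ is in $\mathcal{L}$. The class $\mathcal{L}'$ of Louise prime quivers is the smallest class of quivers such that: any quiver without arrows is in $\mathcal{L}'$; any quiver mutation-equivalent to a quiver in $\mathcal{L}'$ is in $\mathcal{L}'$; and any quiver $Q$ with an arrow $i\to j$ where $i$ is a source or $j$ is a sink, and such that each of $Q\setminus\{i\}$, $Q\setminus\{j\}$ and $Q\setminus\{i,j\}$ is in $\mathcal{L}'$, is in $\mathcal{L}'$. *)

(* Defs.v *)
From mathcomp Require Import all_boot all_order all_algebra.

Set Implicit Arguments.
Unset Strict Implicit.
Unset Printing Implicit Defensive.

(* A quiver with vertex set V is given by its arrow multiplicities: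
   [arrows Q (i, j)] is the number of arrows i -> j.  V may be empty. *)
Record quiver (V : finType) := Quiver {
  arrows :> {ffun V * V -> nat};
  no_loop : [forall i, arrows (i, i) == 0];
  no_2cycle : [forall i, forall j, (arrows (i, j) == 0) || (arrows (j, i) == 0)]
}.

Section Quivers.

Variable V : finType.
Implicit Type Q : quiver V.

Definition arrow Q : rel V := fun i j => 0 < Q (i, j).

Definition arrowless Q : Prop := forall i j, ~~ arrow Q i j.

(* [cycle] is the closed-walk predicate of path.v, true of the empty list. *)
Definition acyclic Q : Prop := forall c : seq V, cycle (arrow Q) c -> c = [::].

Definition is_source Q (i : V) : Prop := forall j, ~~ arrow Q j i.
Definition is_sink Q (i : V) : Prop := forall j, ~~ arrow Q i j.

Definition bi_infinite_path Q (p : int -> V) : Prop :=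
  forall a : int, arrow Q (p a) (p (a + 1)%R).

Definition covering_pair Q (i j : V) : Prop :=
  arrow Q i j /\
  ~ exists p : int -> V,
      bi_infinite_path Q p /\ exists a : int, p a = i /\ p (a + 1)%R = j.

Section Subquiver.

Variables (Q : quiver V) (S : {set V}).

Definition del_arrows :
    {ffun {x : V | x \notin S} * {x : V | x \notin S} -> nat} :=
  [ffun e => Q (val e.1, val e.2)].

Fact del_no_loop : [forall i, del_arrows (i, i) == 0].
Proof. by apply/forallP=> i; rewrite ffunE; apply: (forallP (no_loop Q)). Qed.

Fact del_no_2cycle :
  [forall i, forall j, (del_arrows (i, j) == 0) || (del_arrows (j, i) == 0)].
Proof.
apply/forallP=> i; apply/forallP=> j; rewrite !ffunE /=.
exact: (forallP (forallP (no_2cycle Q) (val i))).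
Qed.

(* The full subquiver Q \ S. *)
Definition del : quiver {x : V | x \notin S} := Quiver del_no_loop del_no_2cycle.

End Subquiver.

Section Mutation.

Variables (Q : quiver V) (i : V).

(* Step 1: an arrow j -> k for each path j -> i -> k. *)
Definition mut_compose (j k : V) : nat := Q (j, k) + Q (j, i) * Q (i, k).

(* Step 2: reverse the arrows at i. *)
Definition mut_reverse (j k : V) : nat :=
  if (j == i) || (k == i) then mut_compose k j else mut_compose j k.

(* Step 3: cancel 2-cycles pair by pair; the subtraction is truncated. *)
Definition mut_arrows : {ffun V * V -> nat} :=
  [ffun e => mut_reverse e.1 e.2 - mut_reverse e.2 e.1].

Fact mut_no_loop : [forall j, mut_arrows (j, j) == 0].
Proof. by apply/forallP=> j; rewrite ffunE subnn. Qed.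

Fact mut_no_2cycle :
  [forall j, forall k, (mut_arrows (j, k) == 0) || (mut_arrows (k, j) == 0)].
Proof.
by apply/forallP=> j; apply/forallP=> k; rewrite !ffunE !subn_eq0 leq_total.
Qed.

Definition mutation : quiver V := Quiver mut_no_loop mut_no_2cycle.

End Mutation.

Definition mutation_equivalent Q Q' : Prop :=
  exists s : seq V, Q' = foldl mutation Q s.

End Quivers.

Inductive louise : forall V : finType, quiver V -> Prop :=
| louise_acyclic (V : finType) (Q : quiver V) :
    acyclic Q -> louise Q
| louise_mutation (V : finType) (Q Q' : quiver V) :
    louise Q -> mutation_equivalent Q Q' -> louise Q'
| louise_covering (V : finType) (Q : quiver V) (i j : V) :
    covering_pair Q i j ->
    louise (del Q [set i]) -> louise (del Q [set j]) ->
    louise (del Q [set i; j]) -> louise Q.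

Inductive louise_prime : forall V : finType, quiver V -> Prop :=
| louise_prime_arrowless (V : finType) (Q : quiver V) :
    arrowless Q -> louise_prime Q
| louise_prime_mutation (V : finType) (Q Q' : quiver V) :
    louise_prime Q -> mutation_equivalent Q Q' -> louise_prime Q'
| louise_prime_arrow (V : finType) (Q : quiver V) (i j : V) :
    arrow Q i j -> is_source Q i \/ is_sink Q j ->
    louise_prime (del Q [set i]) -> louise_prime (del Q [set j]) ->
    louise_prime (del Q [set i; j]) -> louise_prime Q.

(* Main.v *)
(* If the arrow i -> j lies on no bi-infinite path then either no infinite path
   ends at i or none starts at j; up to reversing all arrows, assume the former.
   Walking backwards from i then reaches a source a, which is different from i
   unless i is itself a source.  Mutation at a source only reverses its arrows,
   so mutating at a keeps i -> j, creates no infinite path ending at i, and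
   removes a from the ancestors of i.  Repeating this makes i a source, and
   since a is neither i nor j these mutations commute with the three deletions. *)
Require Import Defs.
From mathcomp Require Import all_boot all_order all_algebra.
From Stdlib Require Import Classical.

Set Implicit Arguments.
Unset Strict Implicit.
Unset Printing Implicit Defensive.

Lemma quiver_eq (V : finType) (Q Q' : quiver V) : Q =1 Q' -> Q = Q'.
Proof.
case: Q Q' => [f lf cf] [g lg cg] /= /ffunP fg.
by case: g / fg lg cg => lg cg; congr Quiver; apply: bool_irrelevance.
Qed.

(** The new entry at [(x, y)] depends only on entries among [a], [x] and [y], all of them outside
    [S]. *)
Lemma del_mutation (V : finType) (Q : quiver V) (S : {set V}) (a : V)
    (aS : a \notin S) :
  del (mutation Q a) S = mutation (del Q S) (exist _ a aS).
Proof.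
apply: quiver_eq => -[x y].
by rewrite !ffunE /mut_reverse /mut_compose !ffunE /= -!val_eqE.
Qed.

Lemma louise_prime_mutate (V : finType) (Q : quiver V) (a : V) :
  louise_prime Q -> louise_prime (mutation Q a).
Proof. by move=> LQ; apply: (louise_prime_mutation LQ); exists [:: a]. Qed.

Lemma louise_prime_del_mutation (V : finType) (Q : quiver V) (S : {set V})
    (a : V) :
  a \notin S -> louise_prime (del Q S) ->
  louise_prime (del (mutation Q a) S).
Proof. by move=> aS LQ; rewrite (del_mutation Q aS); exact: louise_prime_mutate. Qed.

(* The boolean selects Q or its opposite, so that sources and sinks are
   treated together. *)
Definition oriented_arrow (b : bool) (V : finType) (Q : quiver V) : rel V :=
  fun x y => if b then arrow Q x y else arrow Q y x.

(** Indexed backwards from [i]; for [b = false] these are the infinite paths of [Q] that start at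
    [i]. *)
Definition no_infinite_path_to (b : bool) (V : finType) (Q : quiver V) (i : V) :=
  ~ exists f : nat -> V,
      f 0 = i /\ forall n, oriented_arrow b Q (f n.+1) (f n).

(** No path of length 2 passes through a source or a sink, so step 1 adds no arrow; as [Q] has no
    2-cycle, step 3 cancels nothing. *)
Lemma mutation_sourceE (b : bool) (V : finType) (Q : quiver V) (a x y : V) :
    (forall z, ~~ oriented_arrow b Q z a) ->
  mutation Q a (x, y) = if (x == a) || (y == a) then Q (y, x) else Q (x, y).
Proof.
move=> src; have comp u v : mut_compose Q a u v = Q (u, v).
  apply/eqP; rewrite /mut_compose -[X in _ == X]addn0 eqn_add2l muln_eq0.
  case: b src => src; first by have := src u; rewrite -leqNgt leqn0 => ->.
  by have := src v; rewrite -leqNgt leqn0 => ->; rewrite orbT.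
rewrite ffunE /= /mut_reverse !comp (orbC (y == a)).
have := forallP (forallP (no_2cycle Q) x) y.
by case: ifP => _ /orP[] /eqP->; rewrite ?subn0 ?sub0n.
Qed.

Section Oriented.

Variables (b : bool) (V : finType).
Implicit Types (Q : quiver V) (a i j x y : V).

Lemma oriented_arrow_mutation Q a x y :
    (forall z, ~~ oriented_arrow b Q z a) ->
  oriented_arrow b (mutation Q a) x y =
    if (x == a) || (y == a) then oriented_arrow b Q y x
    else oriented_arrow b Q x y.
Proof.
move=> src; rewrite /oriented_arrow /arrow !(mutation_sourceE _ _ src).
by rewrite (orbC (y == a)); case: (_ || _) => /=; case: b.
Qed.

Lemma mutation_source_sink Q a z :
    (forall z, ~~ oriented_arrow b Q z a) ->
  ~~ oriented_arrow b (mutation Q a) a z.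
Proof. by move=> src; rewrite oriented_arrow_mutation ?eqxx ?src. Qed.

Lemma mutation_sourceK Q a :
    (forall z, ~~ oriented_arrow b Q z a) -> mutation (mutation Q a) a = Q.
Proof.
(* [a] has become a sink, that is, a source for [~~ b], so the formula for mutation at a source
   applies again. *)
move=> src; have snk z : ~~ oriented_arrow (~~ b) (mutation Q a) z a.
  by have := mutation_source_sink z src; rewrite /oriented_arrow; case: b.
apply: quiver_eq => -[x y].
rewrite (mutation_sourceE _ _ snk) !(mutation_sourceE _ _ src).
by case: (x == a); case: (y == a).
Qed.

Definition ancestors Q i : {set V} :=
  [set x | connect (fun u v => oriented_arrow b Q v u) i x].

(** Otherwise, choosing predecessors again and again from [i] yields an infinite path ending at
    [i]. *)
Lemma ancestor_source Q i :
    no_infinite_path_to b Q i ->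
  exists2 a, a \in ancestors Q i & forall z, ~~ oriented_arrow b Q z a.
Proof.
move=> fin_i; case: (pickP [pred a in ancestors Q i |
  [forall z, ~~ oriented_arrow b Q z a]]) => [a /andP[ai /forallP] | noa].
  by exists a.
(* The default [x] is never taken on ancestors of [i], which all have a predecessor here. *)
case: fin_i; pose p x := odflt x [pick z | oriented_arrow b Q z x].
have pP x : x \in ancestors Q i -> oriented_arrow b Q (p x) x.
  move=> xi; rewrite /p; case: pickP => //= no_z.
  by case/negP: (noa x); rewrite /= xi; apply/forallP => z; rewrite no_z.
have anc n : iter n p i \in ancestors Q i.
  elim: n => [|n IHn]; first by rewrite inE connect0.
  rewrite inE; apply: (@connect_trans _ _ (iter n p i)).
    by rewrite inE in IHn.
  exact/connect1/pP.
by exists (fun n => iter n p i); split=> // n; exact/pP/anc.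
Qed.

(** After the mutation no oriented arrow leaves [a], so a path ending at [i] avoids [a] and its
    arrows are those of [Q]. *)
Lemma no_infinite_path_mutation Q a i :
    (forall z, ~~ oriented_arrow b Q z a) -> a != i ->
  no_infinite_path_to b Q i -> no_infinite_path_to b (mutation Q a) i.
Proof.
move=> src ai fin_i [f [f0 fP]]; apply: fin_i; exists f; split=> // n.
have fa m : f m != a.
  case: m => [|m]; first by rewrite f0 eq_sym.
  by apply/eqP => fm; have := fP m; rewrite fm (negPf (mutation_source_sink _ src)).
by have := fP n; rewrite oriented_arrow_mutation // !(negPf (fa _)).
Qed.

(** The same avoidance of [a], by induction on a finite path walked backwards from [i]. *)
Lemma ancestors_mutation Q a i :
    (forall z, ~~ oriented_arrow b Q z a) -> a != i ->
  ancestors (mutation Q a) i \subset ancestors Q i :\ a.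
Proof.
move=> src ai; apply/subsetP => x; rewrite !inE => /connectP[p + ->].
elim/last_ind: p => [_|p y IHp] /=; first by rewrite eq_sym ai connect0.
rewrite rcons_path last_rcons => /andP[/IHp /andP[la ip] ly].
have ya : y != a.
  by apply/eqP => ya; move: ly; rewrite ya (negPf (mutation_source_sink _ src)).
rewrite ya; apply: connect_trans ip (connect1 _).
by move: ly; rewrite oriented_arrow_mutation // (negPf ya) (negPf la).
Qed.

(** Serves both covering pairs and acyclic quivers; the induction is on the number of ancestors of
    [i]. *)
Lemma louise_prime_no_infinite_path Q i j :
    oriented_arrow b Q i j -> no_infinite_path_to b Q i ->
    louise_prime (del Q [set i]) -> louise_prime (del Q [set j]) ->
    louise_prime (del Q [set i; j]) ->
  louise_prime Q.
Proof.
move: {2}_.+1 (ltnSn #|ancestors Q i|) => n.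
elim: n Q => // n IHn Q leQn ij fin_i Li Lj Lij.
have [a a_anc src] := ancestor_source fin_i.
have aj : a != j by apply/eqP => aj; have := src i; rewrite aj ij.
have [ai | ai] := eqVneq a i.
  move: src ij; rewrite ai /oriented_arrow; case: b => src ij.
    by apply: (louise_prime_arrow ij) => //; left.
  (* For [b = false] the arrow of [Q] is [j -> i] and [i] is a sink, so the two vertices exchange
     roles. *)
  by apply: (louise_prime_arrow ij) => //; [right | rewrite setUC].
(* [Q] is recovered by mutating [mutation Q a] at [a]; the induction hypothesis is applied to the
   latter. *)
rewrite -(mutation_sourceK src); apply: louise_prime_mutate; apply: IHn.
- apply: leq_ltn_trans (subset_leq_card (ancestors_mutation src ai)) _.
  by move: leQn; rewrite (cardsD1 a) a_anc.
- by rewrite oriented_arrow_mutation // !(eq_sym _ a) (negPf ai) (negPf aj).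
- exact: no_infinite_path_mutation.
- by apply: louise_prime_del_mutation; rewrite ?inE.
- by apply: louise_prime_del_mutation; rewrite ?inE.
- by apply: louise_prime_del_mutation; rewrite ?inE ?negb_or ?ai.
Qed.

End Oriented.

Lemma covering_pair_no_infinite_path (V : finType) (Q : quiver V) (i j : V) :
  covering_pair Q i j ->
  no_infinite_path_to true Q i \/ no_infinite_path_to false Q j.
Proof.
case=> ij nop; case: (classic (no_infinite_path_to true Q i)); first by left.
case/NNPP=> f [f0 fP]; right=> -[g [g0 gP]]; apply: nop.
(* [Negz n] is -(n + 1): the glued path is at [i] at time -1 and at [j] at time 0. *)
exists (fun k => match k with Posz n => g n | Negz n => f n end).
split; last by exists (Negz 0).
case=> [n | [|n]]; first by rewrite -PoszD addn1; exact: gP.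
- by rewrite /= f0 g0.
- have -> : (Negz n.+1 + 1)%R = Negz n by exact: (congr1 Negz (subn0 n)).
  exact: fP.
Qed.

Lemma louise_prime_covering (V : finType) (Q : quiver V) (i j : V) :
    covering_pair Q i j ->
    louise_prime (del Q [set i]) -> louise_prime (del Q [set j]) ->
    louise_prime (del Q [set i; j]) ->
  louise_prime Q.
Proof.
move=> cov Li Lj Lij; have [ij _] := cov.
case: (covering_pair_no_infinite_path cov) => fin.
  exact: (louise_prime_no_infinite_path (b := true) ij fin).
by apply: (louise_prime_no_infinite_path (b := false) ij fin); rewrite // setUC.
Qed.

(** Two of the first [#|V| + 1] vertices of such a path coincide, and the stretch between them is a
    directed cycle. *)
Lemma acyclic_no_infinite_path (V : finType) (Q : quiver V) (i : V) :
  acyclic Q -> no_infinite_path_to true Q i.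
Proof.
move=> acQ [f [_ fP]]; pose g (k : 'I_#|V|.+1) := f k.
have [m [n [mn fmn]]] : exists m n, m < n /\ f m = f n.
  have /injectivePn[m [n mn gmn]] : ~~ injectiveb g.
    by apply/negP => /injectiveP /leq_card; rewrite card_ord ltnn.
  move: mn; rewrite -val_eqE neq_ltn => /orP[lt | lt].
    by exists m, n.
  by exists n, m; split=> //; rewrite gmn.
have : connect (arrow Q) (f n) (f m.+1).
  rewrite -(subnK mn); elim: (n - m.+1) => [|k IHk]; first exact: connect0.
  exact: connect_trans (connect1 (fP _)) IHk.
case/connectP=> p pathp lastp.
suff: f n :: p = [::] by [].
by apply: acQ; rewrite /= rcons_path pathp -lastp -fmn; exact: fP.
Qed.

Lemma acyclic_del (V : finType) (Q : quiver V) (S : {set V}) :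
  acyclic Q -> acyclic (del Q S).
Proof.
move=> acQ c cc; suff /(f_equal size) : map val c = [::].
  by rewrite size_map => /size0nil.
apply: acQ; rewrite cycle_map; congr is_true: cc.
by apply: eq_cycle => x y; rewrite /arrow ffunE.
Qed.

(** Induction on the number of vertices: any arrow will do, since no infinite path ends at its tail
    and the three deletions are acyclic and smaller. *)
Lemma louise_prime_acyclic (V : finType) (Q : quiver V) :
  acyclic Q -> louise_prime Q.
Proof.
move: {2}_.+1 (ltnSn #|V|) => n; elim: n V Q => // n IHn V Q leVn acQ.
have Ldel (S : {set V}) x : x \in S -> louise_prime (del Q S).
  move=> xS; apply: IHn; last exact: acyclic_del.
  rewrite card_sig -ltnS; apply: leq_trans leVn; rewrite ltnS.
  apply: proper_card; apply/properP; split; first exact: subset_predT.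
  by exists x; rewrite ?inE ?negbK.
case: (classic (arrowless Q)) => [|arrQ]; first exact: louise_prime_arrowless.
have [i [j ij]] : exists i j, arrow Q i j.
  apply: NNPP => no; apply: arrQ => i j; apply/negP => ij.
  by apply: no; exists i, j.
apply: (louise_prime_no_infinite_path (b := true) ij).
- exact: acyclic_no_infinite_path.
- by apply: (Ldel _ i); rewrite !inE eqxx.
- by apply: (Ldel _ j); rewrite !inE eqxx.
- by apply: (Ldel _ i); rewrite !inE eqxx.
Qed.

(** A bi-infinite path through the arrow would also enter [i] and leave [j]. *)
Lemma source_sink_covering_pair (V : finType) (Q : quiver V) (i j : V) :
  arrow Q i j -> is_source Q i \/ is_sink Q j -> covering_pair Q i j.
Proof.
move=> ij ext; split=> // -[p [pP [k [pk pk1]]]].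
case: ext => [/(_ (p (k - 1)%R)) | /(_ (p (k + 1 + 1)%R))] /negP[].
  by rewrite -pk -{2}(GRing.subrK 1%R k); exact: pP.
by rewrite -pk1; exact: pP.
Qed.

Lemma louise_prime_louise (V : finType) (Q : quiver V) :
  louise_prime Q -> louise Q.
Proof.
elim=> {V Q} [V Q noQ | V Q Q' _ LQ QQ' | V Q i j ij ext _ Li _ Lj _ Lij].
- apply: louise_acyclic => -[|x c] //= /[!rcons_path] /andP[_].
  by rewrite (negPf (noQ _ _)).
- exact: louise_mutation LQ QQ'.
- exact: louise_covering (source_sink_covering_pair ij ext) Li Lj Lij.
Qed.

Lemma louise_louise_prime (V : finType) (Q : quiver V) :
  louise Q -> louise_prime Q.
Proof.
elim=> {V Q} [V Q | V Q Q' _ LQ QQ' | V Q i j cov _ Li _ Lj _ Lij].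
- exact: louise_prime_acyclic.
- exact: louise_prime_mutation LQ QQ'.
- exact: louise_prime_covering cov Li Lj Lij.
Qed.

Theorem corollary3p5 :
  (forall (V : finType) (Q : quiver V), louise Q ->
     exists Q' : quiver V, mutation_equivalent Q Q' /\ louise_prime Q') /\
  (forall (V : finType) (Q : quiver V), louise Q <-> louise_prime Q).
Proof.
split=> V Q.
  move=> LQ; exists Q; split; last exact: louise_louise_prime.
  by exists [::].
by split; [exact: louise_louise_prime | exact: louise_prime_louise].
Qed.
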